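(* Let $D\ge2$, let $\mathcal{D}=\{0,1,\ldots,D-1\}$, and let $X=\mathcal{D}^{\mathbb{Z}}$ be a Bernoulli shift with left shift $T$ and Bernoulli probability measure $\mu$ such that $\mu([d])\ne0$ for all $d\in\mathcal{D}$. Let $f=\chi_{[0]}$. Then there exists an uncountable subset $S\subseteq X$ such that for all $x,y\in S$ one has $x_j=y_j$ for all $j\le0$, and such that for every $x\in S$ the sequence $$\left(\alpha_{C_k(x)}\left(\frac1k\sum_{i=0}^{k-1}T^i f\right)\right)_{k=1}^\infty$$ is not Cauchy.
   Context: The left shift is $(Tx)_n=x_{n+1}$, and $T^if=f\circ T^i$. A Bernoulli probability measure on $\mathcal{D}^{\mathbb{Z}}$ is the product measure induced by a probability vector $(p(d))_{d\in\mathcal{D}}$ on $\mathcal{D}$, so $\mu([d])=p(d)$. For $d\in\mathcal{D}$, $[d]=\{x\in X:x_0=d\}$, and $\chi_{[0]}$ is the indicator function of $[0]$. $C_k(x)=\{y\in X:y_j=x_j\text{ for }0\le j\le k-1\}$. For measurable $F$ with $\mu(F)>0$, $\alpha_F(f)=\frac1{\mu(F)}\int_Ff\,\mathrm{d}\mu$. *)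

(* Defs.v *)
From HB Require Import structures.
From mathcomp Require Import all_boot all_order all_algebra.
From mathcomp Require Import all_classical all_reals all_analysis.
Import Order.TTheory GRing.Theory Num.Theory.
Import numFieldNormedType.Exports.

Set Implicit Arguments.
Unset Strict Implicit.
Unset Printing Implicit Defensive.

Local Open Scope classical_set_scope.
Local Open Scope ring_scope.

Definition zero_symbol (D : nat) (hD : (2 <= D)%N) : 'I_D := Ordinal (ltnW hD).

(* The type depends on [hD] because a [measurableType] has to be pointed. *)
Definition bisequence (D : nat) (hD : (2 <= D)%N) : Type := int -> 'I_D.

HB.instance Definition _ (D : nat) (hD : (2 <= D)%N) :=
  Choice.copy (bisequence hD) (int -> 'I_D).
HB.instance Definition _ (D : nat) (hD : (2 <= D)%N) :=
  isPointed.Build (bisequence hD) (fun=> zero_symbol hD).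

Definition coordinate_sets (D : nat) (hD : (2 <= D)%N) :
    set (set (bisequence hD)) :=
  [set A | exists (j : int) (B : {set 'I_D}), A = [set x | x j \in B]].

(* Bisequences with the product of the discrete sigma-algebras. *)
Definition fullshift (D : nat) (hD : (2 <= D)%N) :=
  g_sigma_algebraType (@coordinate_sets D hD).

Section FullShift.
Context (D : nat) (hD : (2 <= D)%N).
Local Notation X := (fullshift hD).

Definition symbol_at (x : X) (j : int) : 'I_D := (x : int -> 'I_D) j.

Definition left_shift (x : X) : X := fun n : int => symbol_at x (n + 1).

Definition symbol_cylinder (d : 'I_D) : set X := [set x | symbol_at x 0 = d].

Definition cylinder (k : nat) (x : X) : set X :=
  [set y | forall j : int, 0 <= j <= k%:Z - 1 -> symbol_at y j = symbol_at x j].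

Context (R : realType).

Definition probability_vector (p : 'I_D -> R) : Prop :=
  (forall d, 0 <= p d) /\ \sum_(d < D) p d = 1.

(* The product measure is specified by its values on the measurable rectangles
   over finite sets [J] of coordinates; these form a pi-system generating the
   sigma-algebra, so at most one [mu] satisfies this. *)
Definition is_product_measure (p : 'I_D -> R) (mu : probability X R) : Prop :=
  forall (J : seq int) (B : int -> {set 'I_D}), uniq J ->
    mu [set x : X | forall j, j \in J -> symbol_at x j \in B j]
    = (\prod_(j <- J) \sum_(d in B j) p d)%:E.

Definition is_bernoulli (mu : probability X R) : Prop :=
  exists2 p : 'I_D -> R, probability_vector p & is_product_measure p mu.

(* The function T^i f. *)
Definition shift_fun (i : nat) (f : X -> R) : X -> R := f \o iter i left_shift.

Definition ergodic_average (k : nat) (f : X -> R) : X -> R :=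
  fun x => k%:R^-1 * \sum_(0 <= i < k) shift_fun i f x.

(* alpha_F(f); only meaningful when [F] is measurable and [0 < mu F]. *)
Definition spatial_average (mu : probability X R) (F : set X) (f : X -> R) : R :=
  (fine (mu F))^-1 * (\int[mu]_(x in F) f x)%R.

End FullShift.

Arguments symbol_cylinder {D} hD d.

(* Main.v *)
(* On the cylinder C_k(x) the k-th ergodic average of chi_[0] is constant, equal
   to the frequency of 0 in x_0 ... x_(k-1), so its spatial average is that
   frequency. It then suffices to fill the blocks [3^n, 3^(n+1)) entirely with
   zeros or entirely with ones: the frequency at time 3^(n+1) is >= 2/3 in the
   first case and <= 1/3 in the second. A bit sequence b is encoded in the order
   in which the two fillings occur in each pair of consecutive blocks, which
   gives uncountably many points whose averages oscillate. *)
Require Import Defs.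
From mathcomp Require Import all_boot all_order all_algebra.
From mathcomp Require Import all_classical all_reals all_analysis.
From mathcomp Require Import zify lra.
Import Order.TTheory GRing.Theory Num.Theory.
Import numFieldNormedType.Exports.

Local Open Scope classical_set_scope.
Local Open Scope ring_scope.

(** Cantor's diagonal argument: if [g] codes the range by naturals, let [b] hold at [n] exactly when
    [n] codes a sequence that fails at [n]. Evaluating [b] at its own code is contradictory. *)
Lemma uncountable_range_cantor {T : Type} (F : (nat -> bool) -> T) :
  injective F -> ~ countable (range F).
Proof.
move=> Finj /countable_injP [g ginj].
have hinj b b' : g (F b) = g (F b') -> b = b'.
  by move=> e; apply/Finj/ginj => //; rewrite inE; [exists b|exists b'].
pose b n := `[< exists b', g (F b') = n /\ ~~ b' n >].
have [bt|bt] := boolP (b (g (F b))).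
  by have /asboolP[b' [/hinj ->]] := bt; rewrite bt.
by move/negP: (bt); apply; apply/asboolP; exists b.
Qed.

Section Cylinders.
Context {R : realType} {D : nat} {hD : (2 <= D)%N}.
Local Notation X := (fullshift hD).
Implicit Types (x y : X) (k : nat) (mu : probability X R).

Lemma iter_left_shift i x (j : int) :
  symbol_at (iter i (@left_shift D hD) x) j = symbol_at x (j + i%:Z).
Proof.
elim: i j => [|i IHi] j; first by rewrite addr0.
by rewrite iterS {1}/symbol_at /left_shift IHi -addrA -PoszD add1n.
Qed.

(** Rectangle form required by [is_product_measure]: coordinates 0, ..., k-1 with singleton
    constraints. *)
Lemma cylinderE k x :
  cylinder k x = [set y | forall j : int, j \in map Posz (iota 0 k) ->
                            symbol_at y j \in [set symbol_at x j]%SET].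
Proof.
apply/seteqP; split => y /= yx.
  move=> _ /mapP[i ik ->]; rewrite inE yx //.
  by move: ik; rewrite mem_iota; lia.
case=> j jk; last by lia.
apply/eqP; rewrite -finset.in_set1; apply/yx/map_f.
by rewrite mem_iota; lia.
Qed.

Lemma measurable_cylinder k x : measurable (cylinder k x).
Proof.
rewrite cylinderE; elim: (map Posz _) => [|j J IHJ].
  by rewrite (_ : mkset _ = setT) //; apply/seteqP; split.
rewrite (_ : mkset _ =
    [set y : X | symbol_at y j \in [set symbol_at x j]%SET] `&`
    [set y : X | forall i, i \in J ->
       symbol_at y i \in [set symbol_at x i]%SET]).
  apply: measurableI => //; apply: sub_sigma_algebra.
  by exists j, [set symbol_at x j]%SET.
apply/seteqP; split => y /=.
  move=> yx; split; first by apply: yx; rewrite mem_head.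
  by move=> i iJ; apply: yx; rewrite in_cons iJ orbT.
by move=> [yj yJ] i; rewrite in_cons => /predU1P[->|/yJ].
Qed.

Lemma cylinder_gt0 mu k x : is_bernoulli mu ->
  (forall d : 'I_D, mu (symbol_cylinder hD d) <> 0%E) ->
  0 < fine (mu (cylinder k x)).
Proof.
move=> [p [p0 _] hp] mu0; rewrite cylinderE.
rewrite (hp _ (fun j => [set symbol_at x j]%SET)); last first.
  by rewrite map_inj_uniq ?iota_uniq // => i j [].
rewrite /=; apply: prodr_gt0 => j _; rewrite big_set1 lt_def p0 andbT.
(* A vanishing factor [p d] would be the measure of the one-coordinate rectangle that is the
   cylinder of [d]. *)
set d := symbol_at x j; apply/eqP => pd0; apply: (mu0 d).
have := hp [:: 0] (fun=> [set d]%SET) isT.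
rewrite big_seq1 big_set1 pd0; apply: etrans; congr (mu _).
apply/seteqP; split => y /=.
  by move=> yd i; rewrite inE => /eqP ->; rewrite inE yd.
by move=> /(_ 0); rewrite !inE eqxx => /(_ isT)/eqP.
Qed.

Lemma spatial_average_cylinder mu k x (d : 'I_D) : is_bernoulli mu ->
  (forall d : 'I_D, mu (symbol_cylinder hD d) <> 0%E) ->
  spatial_average mu (cylinder k x)
    (ergodic_average k (\1_(symbol_cylinder hD d) : X -> R)) =
  k%:R^-1 * (\sum_(0 <= i < k) (symbol_at x i%:Z == d))%:R.
Proof.
move=> hmu mu0; rewrite /spatial_average.
set c := RHS.
(* The summands with [i < k] read only coordinates that the cylinder fixes. *)
rewrite (@eq_Rintegral _ _ _ _ _ (fun=> c)).
  rewrite Rintegral_cst; last exact: measurable_cylinder.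
  rewrite mulrCA mulVf ?mulr1 //; apply/lt0r_neq0; exact: cylinder_gt0.
move=> y /set_mem yx; rewrite /ergodic_average /c natr_sum; congr (_ * _).
apply: eq_big_nat => i ik; rewrite /shift_fun /= indicE; congr (_%:R).
rewrite -(yx i%:Z); last by lia.
rewrite -[in RHS](add0r i%:Z) -iter_left_shift; congr nat_of_bool.
by apply/idP/eqP => [/set_mem|?]; last apply/mem_set.
Qed.

End Cylinders.

Section TriadicBlocks.
Context {D : nat} {hD : (2 <= D)%N}.
Local Notation X := (fullshift hD).

Definition block_symbol (b : bool) : 'I_D :=
  if b then zero_symbol hD else Ordinal hD.

Lemma block_symbol_eq0 b : (block_symbol b == zero_symbol hD) = b.
Proof. by case: b; rewrite /block_symbol ?eqxx. Qed.

(* Each bit [b m] governs the two consecutive blocks [3^(2m), 3^(2m+1)) and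
   [3^(2m+1), 3^(2m+2)), exactly one of which is filled with zeros. *)
Definition block_bit (b : nat -> bool) (n : nat) : bool := odd n (+) b n./2.

(** Coordinates up to 0 do not depend on [b], so all these points share their past. *)
Definition block_point (b : nat -> bool) : X := fun j : int =>
  if j is Posz i.+1 then block_symbol (block_bit b (trunc_log 3 i.+1))
  else zero_symbol hD.

Lemma block_pointE b n i : (3 ^ n <= i < 3 ^ n.+1)%N ->
  (symbol_at (block_point b) i%:Z == zero_symbol hD) = block_bit b n.
Proof.
case: i => [|i] hi; first by have := expn_gt0 3 n; lia.
by rewrite /symbol_at /= block_symbol_eq0 (trunc_log_eq _ hi).
Qed.

Lemma block_point_inj : injective block_point.
Proof.
move=> b b' bb'; apply/funext => n.
(* The symbol at position 3^(2n), the start of an even block, reveals [b n]. *)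
have hn : (3 ^ n.*2 <= 3 ^ n.*2 < 3 ^ n.*2.+1)%N by rewrite leqnn ltn_exp2l //=.
have := block_pointE b _ _ hn; rewrite bb' (block_pointE b' _ _ hn).
by rewrite /block_bit odd_double doubleK.
Qed.

(** The block [3^n, 3^(n+1)) contributes all or none of its 2 * 3^n positions, and the earlier ones
    contribute between 0 and 3^n. *)
Lemma block_point_count b n :
  (if block_bit b n
   then (2 * 3 ^ n <= \sum_(0 <= i < 3 ^ n.+1)
           (symbol_at (block_point b) i%:Z == zero_symbol hD))%N
   else (\sum_(0 <= i < 3 ^ n.+1)
           (symbol_at (block_point b) i%:Z == zero_symbol hD) <= 3 ^ n)%N).
Proof.
rewrite (@big_cat_nat _ _ _ (3 ^ n)%N) ?leq_exp2l //=.
rewrite (@eq_big_nat _ _ _ (3 ^ n)%N (3 ^ n.+1)%N _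
  (fun=> block_bit b n : nat)).
  rewrite sum_nat_const_nat.
  have : (\sum_(0 <= i < 3 ^ n)
            (symbol_at (block_point b) i%:Z == zero_symbol hD) <= 3 ^ n)%N.
    rewrite -[leqRHS]muln1 -{2}[(3 ^ n)%N]subn0 -sum_nat_const_nat.
    by apply: leq_sum => i _; case: eqP.
  by rewrite expnS; case: (block_bit b n) => /=; lia.
by move=> i hi; rewrite (block_pointE _ _ _ hi).
Qed.

End TriadicBlocks.

Lemma not_cauchy_oscillating {R : realType} (u : nat -> R) (e : R) : 0 < e ->
  (forall N, exists m n, [/\ (N <= m)%N, (N <= n)%N & e <= `|u m - u n|]) ->
  ~ cauchy (u @ \oo).
Proof.
move=> e0 osc /cauchy_ballP /(_ _ e0) [[A B] /= [[N _ NA] [M _ MB]] AB].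
have [m [n [Nm Nn]]] := osc (maxn N M).
apply/negP; rewrite -ltNge.
apply: (AB (u m, u n)); split => /=.
  by apply: NA; rewrite /= (leq_trans _ Nm) ?leq_maxl.
by apply: MB; rewrite /= (leq_trans _ Nn) ?leq_maxr.
Qed.

Theorem theorem3p7 (R : realType) (D : nat) (hD : (2 <= D)%N)
    (mu : probability (fullshift hD) R) (hmu : is_bernoulli mu)
    (hpos : forall d : 'I_D, mu (symbol_cylinder hD d) <> 0%E) :
  let f : fullshift hD -> R := \1_(symbol_cylinder hD (zero_symbol hD)) in
  exists S : set (fullshift hD),
    [/\ ~ countable S,
        forall x y : fullshift hD, S x -> S y ->
          forall j : int, j <= 0 -> symbol_at x j = symbol_at y j
      & forall x : fullshift hD, S x ->
          ~ cauchy ((fun k : nat =>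
              spatial_average mu (cylinder k.+1 x) (ergodic_average k.+1 f))
              @ \oo)].
Proof.
move=> f; exists (range (@block_point D hD)); split.
- exact/uncountable_range_cantor/block_point_inj.
- by move=> _ _ [b _ <-] [b' _ <-] [[|i]|i].
move=> _ [b _ <-]; set u := (X in X @ \oo).
(* The entry of [u] at index k averages over k+1 terms, hence the predecessor. *)
have uE n : exists c : nat, u (3 ^ n.+1).-1 = (3 ^ n.+1)%:R^-1 * c%:R /\
    if block_bit b n then (2 * 3 ^ n <= c)%N else (c <= 3 ^ n)%N.
  have h := @block_point_count D hD b n.
  eexists; split; last exact: h.
  by rewrite /u prednK ?expn_gt0 // spatial_average_cylinder.
have ub n : if block_bit b n then 2 / 3 <= u (3 ^ n.+1).-1
            else u (3 ^ n.+1).-1 <= 1 / 3.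
  have [c [-> hc]] := uE n.
  have t0 : 0 < (3 ^ n)%:R :> R by rewrite ltr0n expn_gt0.
  rewrite expnS natrM [_^-1 * _]mulrC; case: (block_bit b n) hc => hc.
    rewrite ler_pdivlMr ?mulr_gt0 //.
    by move: hc; rewrite -(ler_nat R) natrM; lra.
  rewrite ler_pdivrMr ?mulr_gt0 //.
  by move: hc; rewrite -(ler_nat R); lra.
apply: (@not_cauchy_oscillating _ u (1 / 3)); first by lra.
(* These are the ends of blocks 2N and 2N+1, whose bits are [b N] and its negation: one average is
   at least 2/3, the other at most 1/3. *)
move=> N; exists (3 ^ N.*2.+1).-1, (3 ^ N.*2.+2).-1.
have ltN n : (n < 3 ^ n)%N by apply: ltn_expl.
split; [by have := ltN N.*2.+1; lia | by have := ltN N.*2.+2; lia |].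
have := ub N.*2; have := ub N.*2.+1.
rewrite /block_bit /= uphalf_double doubleK odd_double /=.
by case: (b N) => /= h1 h2; rewrite ler_normr; apply/orP;
  [left | right]; lra.
Qed.
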